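(* Let $N\ge 2$ and $p_1=\dots=p_N=\frac1N$. Consider FedAvg with partial device participation under Scheme II (sampling $K$ devices uniformly without replacement), $1\le K\le N$, with $E\ge 1$ local steps per round and run for $T\ge 1$ steps with $E\mid T$, applied to $F=\sum_{k=1}^N p_kF_k$. Assume: (1) each $F_k$ is $L$-smooth: $F_k(\mathbf v)\le F_k(\mathbf w)+(\mathbf v-\mathbf w)^\top\nabla F_k(\mathbf w)+\frac L2\|\mathbf v-\mathbf w\|_2^2$ for all $\mathbf v,\mathbf w$; (2) each $F_k$ is $\mu$-strongly convex, $\mu>0$: $F_k(\mathbf v)\ge F_k(\mathbf w)+(\mathbf v-\mathbf w)^\top\nabla F_k(\mathbf w)+\frac \mu2\|\mathbf v-\mathbf w\|_2^2$ for all $\mathbf v,\mathbf w$; (3) $\mathbb E\|\nabla F_k(\mathbf w_t^k,\xi_t^k)-\nabla F_k(\mathbf w_t^k)\|^2\le\sigma_k^2$ for all $k=1,\dots,N$ and $t=0,\dots,T-1$; (4) $\mathbb E\|\nabla F_k(\mathbf w_t^k,\xi_t^k)\|^2\le G^2$ for all $k=1,\dots,N$ and $t=0,\dots,T-1$. Let $\kappa=\frac L\mu$, $\gamma=\max\{8\kappa,E\}$, $\eta_t=\frac{2}{\mu(\gamma+t)}$, $B=\sum_{k=1}^N p_k^2\sigma_k^2+6L\Gamma+8(E-1)^2G^2$ and $C=\frac{N-K}{N-1}\,\frac4KE^2G^2$. Then $$\mathbb E[F(\mathbf w_T)]-F^*\le\frac{\kappa}{\gamma+T-1}\left(\frac{2(B+C)}{\mu}+\frac{\mu\gamma}{2}\,\mathbb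 E\|\mathbf w_1-\mathbf w^*\|^2\right).$$
   Context: Problem: $N$ devices with weights $p_k\ge0$, $\sum_{k=1}^Np_k=1$. Device $k$ holds data $x_{k,1},\dots,x_{k,n_k}$ and has the differentiable local objective $F_k(\mathbf w)=\frac1{n_k}\sum_{j=1}^{n_k}\ell(\mathbf w;x_{k,j})$ on $\mathbb R^d$, where $\ell$ is a loss function differentiable in $\mathbf w$. For a data point $\xi$ of device $k$, $\nabla F_k(\mathbf w,\xi)$ denotes the stochastic gradient $\nabla_{\mathbf w}\ell(\mathbf w;\xi)$. The global objective is $F=\sum_kp_kF_k$; $\mathbf w^*$ is its minimizer, $F^*=F(\mathbf w^* )$, $F_k^*=\min F_k$, and $\Gamma=F^*-\sum_{k=1}^Np_kF_k^*$. FedAvg with partial participation, Scheme II: start from a fixed $\mathbf w_0$, $\mathbf w_0^k=\mathbf w_0$ for all $k$. Let $\mathcal I_E=\{nE: n=1,2,\dots\}$. For $t=0,1,\dots$ and every $k\in\{1,\dots,N\}$, $$\mathbf v_{t+1}^k=\mathbf w_t^k-\eta_t\nabla F_k(\mathbf w_t^k,\xi_t^k),$$ where $\xi_t^k$ is drawn uniformly at random from device $k$'s data, independently across devices and steps. If $t+1\notin\mathcal I_E$, $\mathbf w_{t+1}^k=\mathbf v_{t+1}^k$. If $t+1\in\mathcal I_E$, the server draws a size-$K$ subset $\mathcal S_{t+1}\subset\{1,\dots,N\}$ uniformly without replacement, independently of everything else, and sets $\mathbf w_{t+1}^k=\frac NK\sum_{i\in\mathcal S_{t+1}}p_i\mathbf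 v_{t+1}^{i}$ for all $k$. (Updating all devices locally and using only the sampled ones is equivalent to updating only the sampled ones.) For every $t$, $\mathbf w_t$ denotes the average $\sum_{k=1}^Np_k\mathbf w_t^k$ (which equals the common value of all $\mathbf w_t^k$ when $t\in\mathcal I_E$). $\|\cdot\|$ is the Euclidean norm. *)

(* Defs.v *)
From mathcomp Require Export all_boot all_order all_algebra.
From mathcomp Require Export finmap.
From mathcomp Require Export all_classical all_reals all_analysis.
Export Order.TTheory GRing.Theory Num.Theory numFieldNormedType.Exports.

Set Implicit Arguments.
Unset Strict Implicit.
Unset Printing Implicit Defensive.

Local Open Scope classical_set_scope.
Local Open Scope ring_scope.

Section Euclidean.
Variables (R : realType) (d : nat).
Implicit Types (u v w : 'rV[R]_d) (f : 'rV[R]_d -> R).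

Definition dot u v : R := \sum_(i < d) u 0 i * v 0 i.

(* The library norm on matrices is the sup norm, hence a separate definition. *)
Definition enorm u : R := Num.sqrt (dot u u).

(* The vector of partial derivatives; meaningful where [f] is differentiable. *)
Definition grad f w : 'rV[R]_d := \row_(i < d) 'D_(delta_mx 0 i) f w.

Definition L_smooth (L : R) f : Prop := forall v w,
  f v <= f w + dot (v - w) (grad f w) + L / 2 * enorm (v - w) ^+ 2.

Definition strongly_convex (mu : R) f : Prop := forall v w,
  f v >= f w + dot (v - w) (grad f w) + mu / 2 * enorm (v - w) ^+ 2.

Definition is_minimizer f w : Prop := forall v, f w <= f v.

Definition is_min f (m : R) : Prop :=
  exists2 w, is_minimizer f w & m = f w.

End Euclidean.

Section FedAvg.
Variables (R : realType) (d N : nat) (X : Type).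
(* [x k j] is the [j]-th data point of device [k], which holds [n k] of them. *)
Variables (n : 'I_N -> nat) (x : forall k : 'I_N, 'I_(n k) -> X).
Variables (loss : 'rV[R]_d -> X -> R) (p : 'I_N -> R).

Definition local_objective (k : 'I_N) (w : 'rV[R]_d) : R :=
  (n k)%:R^-1 * \sum_(j < n k) loss w (x j).

Definition global_objective (w : 'rV[R]_d) : R :=
  \sum_(k < N) p k * local_objective k w.

(* A sample of device [k] is represented by the index of its data point, so
   that uniform sampling counts repeated data points with multiplicity. *)
Definition stoch_grad (k : 'I_N) (w : 'rV[R]_d) (j : 'I_(n k)) : 'rV[R]_d :=
  grad (fun u => loss u (x j)) w.

(* [t] belongs to {E, 2E, 3E, ...}. *)
Definition sync_time (E t : nat) : bool := (0 < t)%N && (E %| t)%N.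

(* The local iterate w_t^k along one realisation [xi], [S] of the draws: [xi t k]
   is the sample drawn by device [k] at step [t], and [S t] the set of devices
   drawn at time [t], which matters only at synchronisation times. *)
Fixpoint local_iterate (E K : nat) (eta : nat -> R) (w0 : 'rV[R]_d)
    (xi : nat -> forall k : 'I_N, 'I_(n k)) (S : nat -> {set 'I_N})
    (t : nat) (k : 'I_N) {struct t} : 'rV[R]_d :=
  if t is t'.+1 then
    let w := local_iterate E K eta w0 xi S t' in
    let v i := w i - eta t' *: stoch_grad (w i) (xi t' i) in
    if sync_time E t'.+1
    then (N%:R / K%:R) *: \sum_(i in S t'.+1) p i *: v i
    else v k
  else w0.

Definition average_iterate E K eta w0 xi S (t : nat) : 'rV[R]_d :=
  \sum_(k < N) p k *: local_iterate E K eta w0 xi S t k.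

End FedAvg.

Section Sampling.
Variables (disp : measure_display) (Omega : measurableType disp).
Variables (R : realType) (P : probability Omega R).

Definition mutually_independent (I : choiceType) (D : set I)
    (G : I -> set (set Omega)) : Prop :=
  forall (J : {fset I}) (A : I -> set Omega),
    (forall i, i \in J -> D i /\ G i (A i)) ->
    P (\bigcap_(i in [set` J]) A i) = (\prod_(i <- J) P (A i))%E.

(* A random element of a set carrying the discrete sigma-algebra, together with
   the sigma-algebra that it generates. *)
Definition discrete_random (U : Type) (Y : Omega -> U) : Prop :=
  forall B : set U, measurable (Y @^-1` B).
Definition generated_events (U : Type) (Y : Omega -> U) : set (set Omega) :=
  preimage_set_system setT Y setT.

Variables (N : nat) (n : 'I_N -> nat).
Variables (xi : nat -> forall k : 'I_N, Omega -> 'I_(n k)).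
Variables (S : nat -> Omega -> {set 'I_N}).

(* The draws are indexed by [inl (t, k)] for the sample of device [k] at step
   [t], and by [inr t] for the set of devices drawn at time [t]. *)
Definition draw_events (i : nat * 'I_N + nat) : set (set Omega) :=
  match i with
  | inl (t, k) => generated_events (xi t k)
  | inr t => generated_events (S t)
  end.

(* The draws actually made during the first [T] steps. *)
Definition draws (E T : nat) : set (nat * 'I_N + nat) :=
  [set i | match i with
           | inl (t, _) => (t < T)%N
           | inr t => sync_time E t && (t <= T)%N
           end].

Record schemeII_sampling (E K T : nat) : Prop := SchemeIISampling {
  sample_random : forall t k, (t < T)%N -> discrete_random (xi t k);
  sample_uniform : forall t k (j : 'I_(n k)), (t < T)%N ->
    P [set omega | xi t k omega = j] = ((n k)%:R^-1)%:E;
  devices_random : forall t, sync_time E t -> (t <= T)%N ->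
    discrete_random (S t);
  devices_uniform : forall t (A : {set 'I_N}), sync_time E t -> (t <= T)%N ->
    P [set omega | S t omega = A] =
      (if #|A| == K then ('C(N, K)%:R^-1)%:E else 0%E);
  draws_independent : mutually_independent (draws E T) draw_events
}.

End Sampling.

(* Main.v *)
Require Import Defs.
From mathcomp Require Import perm ring lra zify.

Set Implicit Arguments.
Unset Strict Implicit.
Unset Printing Implicit Defensive.

Local Open Scope classical_set_scope.
Local Open Scope ring_scope.

(* Only finitely many independent draws of finite-valued variables matter, so
   every expectation is an iterated finite average, and averaging once more over
   a single draw leaves it unchanged.  Averaging over the sample of one device
   kills the cross terms of the gradient noise; averaging over the drawn set of
   devices gives the variance of sampling without replacement.  With smoothness
   and strong convexity, and with the drift inside a round bounded by at most E
   gradient steps of comparable sizes, the mean squared distance D_t of the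
   averaged iterate to the minimiser satisfies
     D_(t+1) <= (1 - mu eta_t) D_t + eta_t^2 (B + C),
   whence D_t <= v / (gamma + t - 1) for t >= 1, with
   v = 4 (B + C) / mu^2 + gamma D_1; smoothness of F at its minimiser turns this
   into the bound on F. *)

(** * Averages over independent finite draws *)

Section ProductMean.
Variables (R : realType) (I : choiceType) (U : I -> finType).
Variable q : forall i, U i -> R.
Arguments q : clear implicits.
Implicit Types (f g : (forall i, U i) -> R) (y : forall i, U i) (s : seq I).

(** The conditional expectation given all coordinates other than [i]. It remains a function of [y],
    so averages over different draws compose and commute. *)
Definition resample (i : I) f : (forall i, U i) -> R :=
  fun y => \sum_(a : U i) q i a * f (eqtype.dfwith y a).

(** Coordinates outside [s] keep their value in [y], whence the dependence on [y]. *)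
Definition mean s f : (forall i, U i) -> R := foldr resample f s.

Lemma dfwith_twice y i (a b : U i) : eqtype.dfwith (eqtype.dfwith y a) b = eqtype.dfwith y b.
Proof.
apply: functional_extensionality_dep => j.
have [<-|ij] := eqVneq i j; first by rewrite !dfwith_in.
by rewrite !dfwith_out.
Qed.

Lemma dfwithC y i j (a : U i) (b : U j) : i != j ->
  eqtype.dfwith (eqtype.dfwith y a) b = eqtype.dfwith (eqtype.dfwith y b) a.
Proof.
move=> ij; apply: functional_extensionality_dep => k.
have [<-|jk] := eqVneq j k.
  by rewrite dfwith_in dfwith_out // dfwith_in.
rewrite dfwith_out //; have [<-|ik] := eqVneq i k; first by rewrite !dfwith_in.
by rewrite !dfwith_out.
Qed.

Lemma resampleC i j f : i != j ->
  resample i (resample j f) = resample j (resample i f).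
Proof.
move=> ij; apply: funext => y; rewrite /resample.
under eq_bigr do rewrite big_distrr.
under [RHS]eq_bigr do rewrite big_distrr.
rewrite exchange_big; apply: eq_bigr => a _; apply: eq_bigr => b _ /=.
by rewrite dfwithC // mulrCA.
Qed.

Lemma meanD s f g : mean s (fun y => f y + g y) = fun y => mean s f y + mean s g y.
Proof.
elim: s => //= i s ->; apply: funext => y; rewrite /resample -big_split.
by apply: eq_bigr => a _; rewrite mulrDr.
Qed.

Lemma meanZ s c f : mean s (fun y => c * f y) = fun y => c * mean s f y.
Proof.
elim: s => //= i s ->; apply: funext => y; rewrite /resample big_distrr.
by apply: eq_bigr => a _ /=; rewrite mulrCA.
Qed.

Lemma mean0 s : mean s (fun=> 0) = fun=> 0.
Proof.
elim: s => //= i s ->; apply: funext => y.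
by rewrite /resample big1 // => a _; rewrite mulr0.
Qed.

Lemma mean_sum s (J : Type) (r : seq J) (Q : pred J) (h : J -> (forall i, U i) -> R) :
  mean s (fun y => \sum_(j <- r | Q j) h j y) = fun y => \sum_(j <- r | Q j) mean s (h j) y.
Proof.
elim: r => [|j r IH].
  under [X in mean s X]eq_fun do rewrite big_nil.
  by rewrite mean0; apply: funext => y; rewrite big_nil.
under [X in mean s X]eq_fun do rewrite big_cons.
under [RHS]eq_fun do rewrite big_cons.
case: (Q j); last exact: IH.
by rewrite meanD IH.
Qed.

Hypothesis q_sum1 : forall i, \sum_(a : U i) q i a = 1.

Lemma resample_id i f : resample i (resample i f) = resample i f.
Proof.
apply: funext => y; rewrite {1}/resample.
rewrite (eq_bigr (fun a => q i a * resample i f y)) => [|a _].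
  by rewrite -big_distrl /= q_sum1 mul1r.
by congr (_ * _); apply: eq_bigr => b _; rewrite dfwith_twice.
Qed.

(** Tower property: the extra average commutes outwards past the averages over other indices until
    it meets the last occurrence of [i] in [s], where idempotence absorbs it. *)
Lemma mean_resample i s f : i \in s -> mean s (resample i f) = mean s f.
Proof.
have comm j r : j \notin r -> mean r (resample j f) = resample j (mean r f).
  elim: r => //= k r IH; rewrite inE negb_or => /andP[jk /IH ->].
  by rewrite resampleC // eq_sym.
elim: s => //= j s IH; rewrite inE.
have [is_ _|is_] := boolP (i \in s); first by rewrite IH.
by rewrite orbF => /eqP <-; rewrite comm // resample_id.
Qed.

Lemma resample_cst i f y : (forall a : U i, f (eqtype.dfwith y a) = f y) ->
  resample i f y = f y.
Proof.
move=> fy; rewrite /resample; under eq_bigr do rewrite fy.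
by rewrite -big_distrl /= q_sum1 mul1r.
Qed.

Lemma mean_cst s c y : mean s (fun=> c) y = c.
Proof.
suff -> : mean s (fun=> c) = fun=> c by [].
by elim: s => //= i s ->; apply: funext => z; rewrite resample_cst.
Qed.

Hypothesis q_ge0 : forall i a, 0 <= q i a.

Lemma ler_mean s f g y : (forall y, f y <= g y) -> mean s f y <= mean s g y.
Proof.
move=> fg; elim: s y => //= i s IH y.
by apply: ler_sum => a _; rewrite ler_wpM2l.
Qed.

End ProductMean.

(** * Expectations of functions of finitely many independent draws *)

Section ExpectationMean.
Variables (disp : measure_display) (Omega : measurableType disp).
Variables (R : realType) (P : probability Omega R).
Variables (I : choiceType) (U : I -> finType) (q : forall i, U i -> R).
Arguments q : clear implicits.
Variables (D : set I) (Y : forall i, Omega -> U i).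
Hypothesis Y_random : forall i, D i -> discrete_random (Y i).
Hypothesis Y_law : forall i a, D i -> P [set omega | Y i omega = a] = (q i a)%:E.
Hypothesis Y_indep : mutually_independent P D (fun i => generated_events (Y i)).
Implicit Types (y c : forall i, U i) (s r : seq I).

Definition cylinder r c : set Omega := [set w | all (fun i => Y i w == c i) r].

Lemma measurable_cylinder r c : (forall i, i \in r -> D i) ->
  measurable (cylinder r c).
Proof.
elim: r => [|i r IH] Dr.
  by rewrite (_ : cylinder _ _ = setT) //; apply/seteqP; split.
rewrite (_ : cylinder _ _ = Y i @^-1` [set c i] `&` cylinder r c).
  apply: measurableI; first by apply: Y_random; apply: Dr; rewrite inE eqxx.
  by apply: IH => j jr; apply: Dr; rewrite inE jr orbT.
apply/seteqP; split => w /=; rewrite /cylinder /=.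
  by move=> /andP[/eqP].
by move=> [-> ->]; rewrite eqxx.
Qed.

Lemma probability_cylinder r c : uniq r -> (forall i, i \in r -> D i) ->
  P (cylinder r c) = (\prod_(i <- r) q i (c i))%:E.
Proof.
move=> ur Dr.
have -> : cylinder r c =
    \bigcap_(i in [set` [fset i in r]%fset]) [set w | Y i w = c i].
  apply/seteqP; split => w /=; rewrite /cylinder /=.
    by move=> /allP Yc i /=; rewrite inE => /Yc /eqP.
  by move=> Yc; apply/allP => i ir; apply/eqP; apply: Yc; rewrite /= inE.
rewrite Y_indep; last first.
  move=> i; rewrite inE => ir; split; first exact: Dr.
  by exists [set c i] => //; rewrite setTI.
rewrite (perm_big r) /=; last first.
  by apply: uniq_perm => // i; rewrite inE.
rewrite -prodEFin big_seq [RHS]big_seq; apply: eq_bigr => i ir.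
by rewrite Y_law //; apply: Dr.
Qed.

(** Only the coordinates in [s] are random; the others stay at the fixed [y], as nothing is assumed
    about draws outside [D]. *)
Definition overwrite s y omega : forall i, U i :=
  foldl (fun z i => eqtype.dfwith z (Y i omega)) y s.

(** Generalised for induction on [s]: the coordinates in [s] are still random, while those in [r]
    are pinned to the values [c] by the indicator. One step splits on the value of the head of [s]
    and moves it to [r]. Integrability is carried along because the integral of a finite sum is
    split. *)
Lemma mean_cylinder s r y c (f : (forall i, U i) -> R) :
    uniq (s ++ r) -> (forall i, i \in s ++ r -> D i) ->
  let g := fun w => (f (overwrite s y w) * \1_(cylinder r c) w)%:E in
  P.-integrable setT g /\
  (\int[P]_w g w = (mean q s f y * \prod_(i <- r) q i (c i))%:E)%E.
Proof.
elim: s r y c => [|j s IH] r y c /= us Ds.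
  have mB : measurable (cylinder r c) by exact: measurable_cylinder.
  have iB : P.-integrable setT (EFin \o \1_(cylinder r c)).
    by apply: integrable_indic => //; apply: fin_num_measure.
  split; first exact: (integrableZl measurableT (f y) iB).
  under eq_integral do rewrite EFinM.
  rewrite (integralZl measurableT iB) integral_indic // setIT.
  have EP := probability_cylinder c us Ds.
  by rewrite EFinM -EP.
case/andP: us => jsr usr.
have usr' : uniq (s ++ j :: r).
  by rewrite (perm_uniq (permEl (perm_catCA s [:: j] r))) /= jsr usr.
have Ds' i : i \in s ++ j :: r -> D i.
  by rewrite (perm_mem (permEl (perm_catCA s [:: j] r))); apply: Ds.
have jr : j \notin r by move: jsr; rewrite mem_cat negb_or => /andP[].
(* The part of the integrand on the event that [Y j] takes the value [a]; at each [w] only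
   [a = Y j w] contributes. *)
pose h (a : U j) w := (f (overwrite s (eqtype.dfwith y a) w) *
  \1_(cylinder (j :: r) (eqtype.dfwith c a)) w)%:E.
have Eh w : (f (overwrite s (eqtype.dfwith y (Y j w)) w) * \1_(cylinder r c) w)%:E =
    (\sum_(a : U j) h a w)%E.
  rewrite (bigD1 (Y j w)) //= big1 ?adde0 => [|a aY].
    have EY : all (fun i => Y i w == eqtype.dfwith c (Y j w) i) r =
        all (fun i => Y i w == c i) r.
      apply: eq_in_all => i ir; rewrite dfwith_out //.
      by apply: contraNneq jr => ->.
    congr (_ * _)%:E; rewrite !indicE; congr ((nat_of_bool _)%:R).
    by apply/idP/idP; rewrite !inE /cylinder /= dfwith_in eqxx EY.
  rewrite /h indicE memNset ?mulr0 // /cylinder /= dfwith_in.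
  by move/andP => [/eqP Ya _]; rewrite Ya eqxx in aY.
have ih (a : U j) := IH (j :: r) (eqtype.dfwith y a) (eqtype.dfwith c a) usr' Ds'.
have -> : (fun w => (f (overwrite s (eqtype.dfwith y (Y j w)) w) *
    \1_(cylinder r c) w)%:E) = fun w => (\sum_(a : U j) h a w)%E.
  by apply: funext => w; rewrite Eh.
split; first by apply: integrable_sum => // a _; have [] := ih a.
rewrite integral_sum //=; last by move=> a; have [] := ih a.
rewrite /resample big_distrl /= -sumEFin; apply: eq_bigr => a _.
rewrite /h (ih a).2; congr (_%:E).
rewrite big_cons dfwith_in mulrA; congr (_ * _); first by rewrite mulrC.
rewrite big_seq [RHS]big_seq; apply: eq_bigr => i ir.
by rewrite dfwith_out //; apply: contraNneq jr => ->.
Qed.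

Lemma overwriteE s y w i : i \in s -> overwrite s y w i = Y i w.
Proof.
elim/last_ind: s => // s j IH; rewrite /overwrite foldl_rcons mem_rcons inE.
have [<-|ij /= /IH Ei] := eqVneq j i; first by rewrite dfwith_in.
rewrite dfwith_out; last by [].
by apply: Ei.
Qed.

(** With nothing pinned the cylinder is the whole space, and since [f] reads only the coordinates in
    [s], overwriting those amounts to using [Y] itself. *)
Lemma expectation_mean s y (f : (forall i, U i) -> R) :
    uniq s -> (forall i, i \in s -> D i) ->
    (forall y y', (forall i, i \in s -> y i = y' i) -> f y = f y') ->
  ('E_P[fun w => f (fun i => Y i w)] = (mean q s f y)%:E)%E.
Proof.
move=> us Ds fs; have [||_] := @mean_cylinder s [::] y y f.
  1,2: by rewrite cats0.
rewrite big_nil mulr1 unlock => <-; apply: eq_integral => w _.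
rewrite indicE mem_set // mulr1; congr (_%:E).
by apply: fs => i si; rewrite overwriteE.
Qed.

End ExpectationMean.

(** * Euclidean geometry and one gradient step *)

Section Dot.
Variables (R : realType) (d : nat).
Implicit Types (u v w a b : 'rV[R]_d) (c : R).

Lemma dotC u v : dot u v = dot v u.
Proof. by apply: eq_bigr => i _; rewrite mulrC. Qed.

Lemma dotDl u v w : dot (u + v) w = dot u w + dot v w.
Proof. by rewrite /dot -big_split; apply: eq_bigr => i _; rewrite mxE mulrDl. Qed.

Lemma dotDr u v w : dot w (u + v) = dot w u + dot w v.
Proof. by rewrite !(dotC w) dotDl. Qed.

Lemma dotZl c u v : dot (c *: u) v = c * dot u v.
Proof. by rewrite /dot big_distrr; apply: eq_bigr => i _; rewrite mxE /= mulrA. Qed.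

Lemma dotZr c u v : dot v (c *: u) = c * dot v u.
Proof. by rewrite dotC dotZl dotC. Qed.

Lemma dotNl u v : dot (- u) v = - dot u v.
Proof. by rewrite -scaleN1r dotZl mulN1r. Qed.

Lemma dotNr u v : dot v (- u) = - dot v u.
Proof. by rewrite dotC dotNl dotC. Qed.

Lemma dot0l v : dot 0 v = 0.
Proof. by rewrite -(scale0r 0) dotZl mul0r. Qed.

Lemma dot_suml (J : Type) (r : seq J) (Q : pred J) (h : J -> 'rV[R]_d) v :
  dot (\sum_(j <- r | Q j) h j) v = \sum_(j <- r | Q j) dot (h j) v.
Proof.
elim: r => [|j r IH]; first by rewrite !big_nil dot0l.
by rewrite !big_cons; case: (Q j); rewrite // dotDl IH.
Qed.

Lemma dot_sumr (J : Type) (r : seq J) (Q : pred J) (h : J -> 'rV[R]_d) v :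
  dot v (\sum_(j <- r | Q j) h j) = \sum_(j <- r | Q j) dot v (h j).
Proof. by rewrite dotC dot_suml; apply: eq_bigr => j _; rewrite dotC. Qed.

Definition dotE := (dotDl, dotDr, dotNl, dotNr, dotZl, dotZr).

Lemma dot_ge0 u : 0 <= dot u u.
Proof. by apply: sumr_ge0 => i _; rewrite -expr2 sqr_ge0. Qed.

Lemma enorm_sqr u : enorm u ^+ 2 = dot u u.
Proof. by rewrite sqr_sqrtr ?dot_ge0. Qed.

(** Young's inequality, from the nonnegative square of [a + c *: b]. *)
Lemma dot_young c a b : - (2 * c * dot a b) <= dot a a + c ^+ 2 * dot b b.
Proof.
have := dot_ge0 (a + c *: b); rewrite !dotE (dotC b a); nra.
Qed.

(** The cross term vanishes because deviations from the weighted mean average to zero. *)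
Lemma sum_dot_bias_variance (J : finType) (p : J -> R) (u : J -> 'rV[R]_d) a :
    \sum_j p j = 1 -> let m := \sum_j p j *: u j in
  \sum_j p j * dot (u j - a) (u j - a) =
  \sum_j p j * dot (u j - m) (u j - m) + dot (m - a) (m - a).
Proof.
move=> p1 m.
have cross : \sum_j p j * dot (u j - m) (m - a) = 0.
  under eq_bigr do rewrite -dotZl.
  rewrite -dot_suml; under eq_bigr do rewrite scalerBr.
  by rewrite sumrB -scaler_suml p1 scale1r subrr dot0l.
transitivity (\sum_j (p j * dot (u j - m) (u j - m) +
   (2 * (p j * dot (u j - m) (m - a)) + p j * dot (m - a) (m - a)))).
  apply: eq_bigr => j _; have -> : u j - a = (u j - m) + (m - a) by rewrite subrKA.
  move: (u j - m) (m - a) => b c; rewrite !dotE (dotC c b); ring.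
by rewrite !big_split -big_distrr /= cross -big_distrl /= p1 mulr0 add0r mul1r.
Qed.

(** Jensen for the squared norm: the decomposition around 0 with the variance dropped. *)
Lemma dot_mean_le (J : finType) (p : J -> R) (u : J -> 'rV[R]_d) :
    (forall j, 0 <= p j) -> \sum_j p j = 1 ->
  dot (\sum_j p j *: u j) (\sum_j p j *: u j) <= \sum_j p j * dot (u j) (u j).
Proof.
move=> p0 p1; have := sum_dot_bias_variance u 0 p1 => /= eq0.
under [leRHS]eq_bigr do rewrite -(subr0 (u _)).
rewrite eq0 subr0 lerDr; apply: sumr_ge0 => j _.
by rewrite mulr_ge0 ?dot_ge0.
Qed.

(** The mean is the best centre in mean square. Below, [a] is the common iterate at the start of a
    round. *)
Lemma sum_dot_centered_le (J : finType) (p : J -> R) (u : J -> 'rV[R]_d) a :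
    \sum_j p j = 1 ->
  \sum_j p j * dot (u j - \sum_i p i *: u i) (u j - \sum_i p i *: u i) <=
  \sum_j p j * dot (u j - a) (u j - a).
Proof.
by move=> p1; rewrite (sum_dot_bias_variance u a p1) lerDl dot_ge0.
Qed.

(** Jensen with equal weights, rescaled; the empty sum is separate because its weights do not add up
    to 1. *)
Lemma dot_sum_le m (u : 'I_m -> 'rV[R]_d) :
  dot (\sum_i u i) (\sum_i u i) <= m%:R * \sum_i dot (u i) (u i).
Proof.
case: m u => [|m] u; first by rewrite !big_ord0 dot0l mulr0.
have m0 : 0 < m.+1%:R :> R by [].
have p1 : \sum_(j < m.+1) m.+1%:R^-1 = 1 :> R.
  by rewrite sumr_const card_ord -[_^-1 *+ _]mulr_natr mulVf ?gt_eqF.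
have p0 (j : 'I_m.+1) : 0 <= m.+1%:R^-1 :> R by rewrite invr_ge0 ltW.
have := dot_mean_le u p0 p1.
rewrite -scaler_sumr dotZl dotZr -big_distrr /=.
by rewrite ler_pM2l ?invr_gt0 // ler_pdivrMl.
Qed.

(** The point [w - L^-1 *: g] minimises the quadratic upper bound, and [m] lies below the value
    there. *)
Lemma smooth_grad_le (L m : R) (f : 'rV[R]_d -> R) w g : 0 < L ->
    (forall v, f v <= f w + dot (v - w) g + L / 2 * dot (v - w) (v - w)) ->
    (forall v, m <= f v) ->
  dot g g <= 2 * L * (f w - m).
Proof.
move=> L0 fL fm; have := le_trans (fm _) (fL (w - L^-1 *: g)).
rewrite [w - _ - w]addrAC subrr add0r !dotE => h.
have {}h : m <= f w - L^-1 * dot g g / 2.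
  by apply: le_trans h _; rewrite le_eqVlt; apply/orP; left; apply/eqP; field; rewrite gt_eqF.
have : L^-1 * dot g g <= 2 * (f w - m) by lra.
by rewrite ler_pdivrMl // mulrA (mulrC L).
Qed.

Lemma dot_eq0 (u : 'rV[R]_d) : dot u u = 0 -> u = 0.
Proof.
move=> u0; apply/rowP => i; rewrite mxE; apply/eqP; rewrite -sqrf_eq0 expr2; apply/eqP.
by apply: (psumr_eq0P _ u0) => // j _; rewrite -expr2 sqr_ge0.
Qed.

(** At a minimiser the previous bound with [m = f w] forces [g = 0], so the linear term
    disappears. *)
Lemma smooth_minimizer_le (L : R) (f : 'rV[R]_d -> R) w g : 0 < L ->
    (forall v, f v <= f w + dot (v - w) g + L / 2 * dot (v - w) (v - w)) ->
    is_minimizer f w ->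
  forall v, f v <= f w + L / 2 * dot (v - w) (v - w).
Proof.
move=> L0 fL fw v; have := smooth_grad_le L0 fL fw; rewrite subrr mulr0 => gg.
have /dot_eq0 g0 : dot g g = 0 by apply/eqP; rewrite eq_le gg dot_ge0.
by have := fL v; rewrite g0 dotC dot0l addr0.
Qed.

(** Both quadratic bounds share the same linear part; comparing them at one nonzero displacement,
    available as [d] is positive, compares the curvatures. *)
Lemma smooth_convex_le (L mu : R) (f : 'rV[R]_d -> R) : (0 < d)%N ->
  L_smooth L f -> strongly_convex mu f -> mu <= L.
Proof.
move=> d0 fL fmu; have := le_trans (fmu (const_mx 1) 0) (fL (const_mx 1) 0).
rewrite lerD2l !enorm_sqr subr0.
have -> : dot (const_mx 1 : 'rV[R]_d) (const_mx 1) = d%:R.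
  rewrite /dot (eq_bigr (fun=> 1)) => [|i _]; last by rewrite !mxE mulr1.
  by rewrite sumr_const card_ord.
rewrite ler_pM2r ?ltr0n //; lra.
Qed.

End Dot.

(** * Contraction of one averaged exact gradient step *)

Section OneStep.
Variables (R : realType) (d N : nat) (p : 'I_N -> R).
Variables (f : 'I_N -> 'rV[R]_d -> R) (g : 'I_N -> 'rV[R]_d -> 'rV[R]_d).
Variables (L mu eta : R) (m : 'I_N -> R) (wstar : 'rV[R]_d).
Hypotheses (p_ge0 : forall k, 0 <= p k) (p_sum1 : \sum_k p k = 1).
Hypotheses (L_gt0 : 0 < L) (mu_gt0 : 0 < mu).
Hypotheses (eta_gt0 : 0 < eta) (eta_le : 4 * L * eta <= 1).
Hypothesis f_smooth : forall k v w,
  f k v <= f k w + dot (v - w) (g k w) + L / 2 * dot (v - w) (v - w).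
Hypothesis f_convex : forall k v w,
  f k w + dot (v - w) (g k w) + mu / 2 * dot (v - w) (v - w) <= f k v.
Hypothesis f_min : forall k v, m k <= f k v.
Hypothesis wstar_min : forall v, \sum_k p k * f k wstar <= \sum_k p k * f k v.

Variable w : 'I_N -> 'rV[R]_d.
Local Notation wbar := (\sum_k p k *: w k).
Local Notation gbar := (\sum_k p k *: g k (w k)).

(** The square is expanded, the inner product is split device by device through [w k], each device
    is bounded by smoothness and convexity, and the bounds are summed. The last bracket measures the
    heterogeneity of the devices. *)
Lemma gradient_step_contraction :
  dot (wbar - wstar - eta *: gbar) (wbar - wstar - eta *: gbar) <=
  (1 - mu * eta) * dot (wbar - wstar) (wbar - wstar)
  + 2 * \sum_k p k * dot (w k - wbar) (w k - wbar)
  + 6 * L * eta ^+ 2 * (\sum_k p k * f k wstar - \sum_k p k * m k).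
Proof.
set wb := wbar; set gb := gbar; set a := wb - wstar.
pose D k := dot (w k - wb) (w k - wb).
pose Z k := dot (w k - wstar) (w k - wstar).
have ga : dot a gb = \sum_k p k * (dot (wb - w k) (g k (w k))
    + dot (w k - wstar) (g k (w k))).
  rewrite dot_sumr; apply: eq_bigr => k _; rewrite dotZr -dotDl; congr (_ * dot _ _).
  by rewrite subrKA.
have gg : dot gb gb <= \sum_k p k * dot (g k (w k)) (g k (w k)).
  exact: dot_mean_le.
(* After [Y1], [G1] and [C1] the value [f k (w k)] has coefficient [4 * L * eta ^+ 2 - 2 * eta],
   which is [- 2 * eta * e]. *)
pose e := 1 - 2 * L * eta.
have [L0 mu0 eta0 eta4] := And4 L_gt0 mu_gt0 eta_gt0 eta_le.
(* [Y1] trades the first product for [D k] and a squared gradient, which [G1] turns into a function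
   gap; [C1] treats the second product. Then [C2], [Y2] and [G2] move from [f k (w k)] to [f k wb]
   at the price of [e * D k]. *)
have step k : - 2 * eta * (dot (wb - w k) (g k (w k)) + dot (w k - wstar) (g k (w k)))
    + eta ^+ 2 * dot (g k (w k)) (g k (w k)) <=
    (1 + e) * D k - mu * eta * Z k + 2 * eta * e * (L * eta - 1) * f k wb
    - (4 * L * eta ^+ 2 + 2 * L * eta ^+ 2 * e) * m k + 2 * eta * f k wstar.
  have G1 := smooth_grad_le L_gt0 (fun v => f_smooth k v (w k)) (f_min k).
  have G2 := smooth_grad_le L_gt0 (fun v => f_smooth k v wb) (f_min k).
  have Y1 := dot_young eta (wb - w k) (g k (w k)).
  have Y2 := dot_young eta (w k - wb) (g k wb).
  have C1 := f_convex k wstar (w k).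
  have C2 := f_convex k (w k) wb.
  rewrite -(opprB (w k) wstar) !dotNl dotNr opprK -/(Z k) in C1.
  rewrite -(opprB (w k) wb) !(dotNl, dotNr) opprK -/(D k) in Y1.
  rewrite -(opprB (w k) wb) dotNl.
  rewrite -/(D k) in Y2 C2.
  have D0 : 0 <= D k by exact: dot_ge0.
  have e0 : 0 <= e by rewrite /e; lra.
  have muD : 0 <= mu / 2 * D k by rewrite mulr_ge0 // divr_ge0 // ltW.
  have eta2 : 0 <= eta ^+ 2 by rewrite sqr_ge0.
  have eta20 : 0 <= 2 * eta by rewrite mulr_ge0 // ltW.
  have etae : 0 <= 2 * eta * e by rewrite mulr_ge0.
  have eeta2 : 0 <= e * eta ^+ 2 by rewrite mulr_ge0.
  have A1 := ler_wpM2l eta20 C1.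
  have A2 : 2 * eta * e * (f k wb + dot (w k - wb) (g k wb)) <= 2 * eta * e * f k (w k).
    by apply: ler_wpM2l => //; lra.
  have A3 := ler_wpM2l e0 Y2.
  have A4 := ler_wpM2l eta2 G1.
  have A5 := ler_wpM2l eeta2 G2.
  move: A1 A2 A3 A4 A5 Y1; rewrite /e.
  move: (dot _ _) (dot _ _) (dot _ _) (dot _ _) (dot _ _) (Z k) (D k).
  move: (f k _) (f k _) (f k _) (m k).
  clear -R; move=> *; lra.
have a2 : dot a a <= \sum_k p k * Z k.
  by rewrite (sum_dot_bias_variance w wstar p_sum1) lerDr sumr_ge0 // => k _;
    rewrite mulr_ge0 ?dot_ge0.
have S : \sum_k p k * (- 2 * eta * (dot (wb - w k) (g k (w k))
     + dot (w k - wstar) (g k (w k))) + eta ^+ 2 * dot (g k (w k)) (g k (w k))) <=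
   \sum_k p k * ((1 + e) * D k - mu * eta * Z k + 2 * eta * e * (L * eta - 1) * f k wb
    - (4 * L * eta ^+ 2 + 2 * L * eta ^+ 2 * e) * m k + 2 * eta * f k wstar).
  by apply: ler_sum => k _; rewrite ler_wpM2l.
have El : \sum_k p k * (- 2 * eta * (dot (wb - w k) (g k (w k))
     + dot (w k - wstar) (g k (w k))) + eta ^+ 2 * dot (g k (w k)) (g k (w k))) =
   - 2 * eta * dot a gb + eta ^+ 2 * \sum_k p k * dot (g k (w k)) (g k (w k)).
  rewrite ga !big_distrr -big_split; apply: eq_bigr => k _ /=; ring.
have Er : \sum_k p k * ((1 + e) * D k - mu * eta * Z k
    + 2 * eta * e * (L * eta - 1) * f k wb
    - (4 * L * eta ^+ 2 + 2 * L * eta ^+ 2 * e) * m k + 2 * eta * f k wstar) =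
    (1 + e) * (\sum_k p k * D k) - mu * eta * (\sum_k p k * Z k)
    + 2 * eta * e * (L * eta - 1) * (\sum_k p k * f k wb)
    - (4 * L * eta ^+ 2 + 2 * L * eta ^+ 2 * e) * (\sum_k p k * m k)
    + 2 * eta * (\sum_k p k * f k wstar).
  rewrite -!mulNr !big_distrr -!big_split; apply: eq_bigr => k _ /=; ring.
rewrite {}El {}Er in S.
have expand : dot (a - eta *: gb) (a - eta *: gb) =
    dot a a - 2 * eta * dot a gb + eta ^+ 2 * dot gb gb.
  by move: (a) (gb) => u v; rewrite !dotE (dotC v u); ring.
rewrite expand; clear expand ga step.
have mF : \sum_k p k * m k <= \sum_k p k * f k wstar.
  by apply: ler_sum => k _; rewrite ler_wpM2l.
have D0 : 0 <= \sum_k p k * D k.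
  by apply: sumr_ge0 => k _; rewrite mulr_ge0 ?dot_ge0.
have e0 : 0 <= e by rewrite /e; lra.
have e1 : e <= 1 by rewrite /e; nra.
have B1 := wstar_min wb.
have eta2 : 0 <= eta ^+ 2 by rewrite sqr_ge0.
(* The value of the objective at [wb] enters with the opposite of this coefficient, so minimality of
   [wstar] lets it be replaced by the minimum. The gap then has total factor
   [(4 + 2 * e) * L * eta ^+ 2]. *)
have c1 : 0 <= 2 * eta * e * (1 - L * eta).
  have Le : 0 < L * eta by rewrite mulr_gt0.
  by rewrite mulr_ge0 ?mulr_ge0 //; lra.
have A1 := ler_wpM2l c1 B1.
have A2 := ler_wpM2l (mulr_ge0 (ltW mu_gt0) (ltW eta_gt0)) a2.
have A3 := ler_wpM2l eta2 gg.
(* Rounding [e] up to 1 turns [1 + e] into 2 and [4 + 2 * e] into 6. *)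
have A4 : 0 <= (1 - e) * (\sum_k p k * D k) by rewrite mulr_ge0 // subr_ge0.
have A5 : 0 <= (1 - e) * (2 * L * eta ^+ 2) *
    (\sum_k p k * f k wstar - \sum_k p k * m k).
  by rewrite !mulr_ge0 ?subr_ge0 // ltW.
rewrite -/(D _) in A4 *.
move: S A1 A2 A3 A4 A5.
move: (\sum_k p k * f k wstar) (\sum_k p k * f k wb) (\sum_k p k * m k) => Fs Fb M.
rewrite /D; move: (\sum_k _) (\sum_k _) (\sum_k _) (dot _ _) (dot _ _) (dot _ _).
rewrite /e; move=> *; lra.
Qed.

End OneStep.

(** * Sampling without replacement *)

Section WithoutReplacement.
Variables (R : realType) (N K : nat).
Hypotheses (N_ge2 : (2 <= N)%N) (K_gt0 : (1 <= K)%N) (K_leN : (K <= N)%N).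

Definition without_replacement (A : {set 'I_N}) : R :=
  if #|A| == K then 'C(N, K)%:R^-1 else 0.

Local Notation q := without_replacement.

Lemma without_replacement_ge0 A : 0 <= q A.
Proof. by rewrite /q; case: ifP => // _; rewrite invr_ge0. Qed.

Lemma without_replacement_sum1 : \sum_A q A = 1.
Proof.
rewrite -big_mkcond sumr_const /=.
rewrite (eq_card (B := [set A : {set 'I_N} | #|A| == K]%SET)); last by move=> A; rewrite inE.
rewrite card_draws card_ord -[_^-1 *+ _]mulr_natr mulVf // pnatr_eq0 -lt0n bin_gt0 //.
Qed.

(** The law depends only on cardinality, so it is invariant under relabelling the devices. *)
Lemma without_replacement_perm (s : {perm 'I_N}) (h : {set 'I_N} -> R) :
  \sum_A q A * h A = \sum_A q A * h (s @: A)%SET.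
Proof.
rewrite (reindex_inj (imset_inj (@perm_inj _ s))) /=.
by apply: eq_bigr => A _; rewrite /q card_imset //; exact: perm_inj.
Qed.

(** By symmetry all inclusion probabilities agree, and they add up to the expected cardinality
    [K]. *)
Lemma without_replacement_mem i : \sum_A q A * (i \in A)%:R = K%:R / N%:R.
Proof.
have cst j : \sum_A q A * (j \in A)%:R = \sum_A q A * (i \in A)%:R.
  rewrite (without_replacement_perm (tperm i j)); apply: eq_bigr => A _.
  by rewrite -{1}(tpermL i j) mem_imset //; exact: perm_inj.
have : \sum_(j < N) \sum_A q A * (j \in A)%:R = K%:R.
  rewrite exchange_big /=; transitivity (\sum_A q A * K%:R); last first.
    by rewrite -big_distrl /= without_replacement_sum1 mul1r.
  apply: eq_bigr => A _; rewrite -big_distrr /= -natr_sum -big_mkcond /= sum1_card.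
  by rewrite /q; case: eqP => [->//|_]; rewrite !mul0r.
under eq_bigr do rewrite cst.
rewrite sumr_const card_ord => <-.
by rewrite -[X in _ = X / _]mulr_natr mulfK // pnatr_eq0 -lt0n (leq_trans _ N_ge2).
Qed.

(** Transpositions fixing [i] make the probability independent of the second index. Summed over the
    [N - 1] choices it counts the other [K - 1] members when [i] is drawn. *)
Lemma without_replacement_mem2 i j : i != j ->
  \sum_A q A * ((i \in A)%:R * (j \in A)%:R) =
  K%:R * (K%:R - 1) / (N%:R * (N%:R - 1)).
Proof.
move=> ij.
have cst k : i != k -> \sum_A q A * ((i \in A)%:R * (k \in A)%:R) =
    \sum_A q A * ((i \in A)%:R * (j \in A)%:R).
  move=> ik; rewrite (without_replacement_perm (tperm j k)); apply: eq_bigr => A _.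
  have ki : (k \in tperm j k @: A)%SET = (j \in A).
    by rewrite -[X in X \in _](tpermL j k) mem_imset //; exact: perm_inj.
  have ii : (i \in tperm j k @: A)%SET = (i \in A).
    by rewrite -[X in X \in _](tpermD (x := j) (y := k) (z := i)) 1?eq_sym // mem_imset //;
      exact: perm_inj.
  by rewrite ki ii.
have : \sum_(k < N | k != i) \sum_A q A * ((i \in A)%:R * (k \in A)%:R) =
    (K%:R - 1) * (K%:R / N%:R).
  rewrite exchange_big -(without_replacement_mem i) big_distrr /=.
  apply: eq_bigr => A _; rewrite -big_distrr /= -big_distrr /= /q.
  have [AK|_] := eqVneq #|A| K; last by rewrite !mul0r mulr0.
  have [iA|_] := boolP (i \in A); last by rewrite mul0r !mulr0.
  have -> : \sum_(k < N | k != i) (k \in A)%:R = K%:R - 1 :> R.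
    rewrite -AK -sum1_card [X in _ = X%:R - _]big_mkcond natr_sum [in RHS](bigD1 i) //= iA.
    by rewrite [RHS]addrAC subrr add0r; apply: eq_bigr => k _; case: (k \in A).
  by rewrite mulrCA mulr1 mul1r mulrC.
rewrite (eq_bigr (fun=> \sum_A q A * ((i \in A)%:R * (j \in A)%:R))); last first.
  by move=> k ki; rewrite cst // eq_sym.
have N0 : (0 < N)%N by exact: leq_trans N_ge2.
rewrite sumr_const cardC1 card_ord -[X in X = _]mulr_natl -subn1 natrB // => h.
have N1 : N%:R - 1 != 0 :> R by rewrite subr_eq0 pnatr_eq1 gtn_eqF.
have N2 : N%:R != 0 :> R by rewrite pnatr_eq0 -lt0n.
by apply: (mulfI N1); rewrite h; field; rewrite N1 N2.
Qed.

(** The sample mean is unbiased, and its variance carries the finite population correction. With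
    centred vectors [z], the linear terms cancel, and the quadratic ones reduce to the diagonal
    because the [z i] sum to zero. *)
Lemma without_replacement_variance d (v : 'I_N -> 'rV[R]_d) (a : 'rV[R]_d) :
  let vb := \sum_k N%:R^-1 *: v k in
  \sum_A q A * dot (K%:R^-1 *: (\sum_(i in A) v i) - a)
                   (K%:R^-1 *: (\sum_(i in A) v i) - a) =
  dot (vb - a) (vb - a) + (N%:R - K%:R) / (K%:R * (N%:R - 1)) *
    \sum_k N%:R^-1 * dot (v k - vb) (v k - vb).
Proof.
move=> vb; pose z i := v i - vb; pose b := vb - a.
have N0 : (0 < N)%N by exact: leq_trans N_ge2.
have N1 : N%:R - 1 != 0 :> R by rewrite subr_eq0 pnatr_eq1 gtn_eqF.
have N2 : N%:R != 0 :> R by rewrite pnatr_eq0 -lt0n.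
have K2 : K%:R != 0 :> R by rewrite pnatr_eq0 -lt0n.
have z0 : \sum_i z i = 0.
  rewrite sumrB sumr_const card_ord /vb -scaler_sumr -scaler_nat scalerA divff //.
  by rewrite scale1r subrr.
have z_orth u : \sum_j dot u (z j) = 0 by rewrite -dot_sumr z0 dotC dot0l.
(* [c1] and [c2] are the inclusion probabilities of one device and of two distinct devices. *)
pose c1 : R := K%:R / N%:R.
pose c2 : R := K%:R * (K%:R - 1) / (N%:R * (N%:R - 1)).
(* Indicators replace sums over the random set [A], so that the sum over [A] can be moved
   innermost. *)
transitivity (\sum_A q A * (dot b b + 2 * K%:R^-1 * \sum_i (i \in A)%:R * dot b (z i)
   + K%:R^-1 ^+ 2 * \sum_i \sum_j (i \in A)%:R * (j \in A)%:R * dot (z i) (z j))).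
  apply: eq_bigr => A _; rewrite /q; have [AK|_] := eqVneq #|A| K; last by rewrite !mul0r.
  congr (_ * _).
  pose zA := \sum_i (i \in A)%:R *: z i.
  have -> : K%:R^-1 *: (\sum_(i in A) v i) - a = b + K%:R^-1 *: zA.
    have -> : zA = \sum_(i in A) z i.
      rewrite [RHS]big_mkcond; apply: eq_bigr => i _.
      by case: (i \in A); rewrite ?scale1r ?scale0r.
    rewrite sumrB sumr_const AK scalerBr -[vb *+ K]scaler_nat.
    rewrite [K%:R^-1 *: (K%:R *: _)]scalerA mulVf // scale1r.
    by rewrite [RHS]addrC addrA subrK.
  have -> : \sum_i (i \in A)%:R * dot b (z i) = dot b zA.
    by rewrite dot_sumr; apply: eq_bigr => i _; rewrite dotZr.
  have -> : \sum_i \sum_j (i \in A)%:R * (j \in A)%:R * dot (z i) (z j) = dot zA zA.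
    rewrite dot_suml; apply: eq_bigr => i _; rewrite dot_sumr; apply: eq_bigr => j _.
    by rewrite dotZl dotZr mulrA.
  by move: b zA => u u'; rewrite !dotE (dotC u' u); ring.
rewrite (eq_bigr (fun A => q A * dot b b + (2 * K%:R^-1 *
    \sum_i (q A * (i \in A)%:R) * dot b (z i) + K%:R^-1 ^+ 2 *
    \sum_i \sum_j (q A * ((i \in A)%:R * (j \in A)%:R)) * dot (z i) (z j)))); last first.
  move=> A _; rewrite !mulrDr -addrA; congr (_ + (_ + _)).
    rewrite mulrCA; congr (_ * _); rewrite big_distrr.
    by apply: eq_bigr => i _ /=; rewrite mulrA.
  rewrite mulrCA; congr (_ * _); rewrite big_distrr; apply: eq_bigr => i _.
  by rewrite big_distrr; apply: eq_bigr => j _ /=; exact: mulrA.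
rewrite !big_split /= -big_distrl /= without_replacement_sum1 mul1r -!big_distrr /=.
rewrite exchange_big /=.
under eq_bigr do rewrite -big_distrl /= without_replacement_mem.
rewrite -big_distrr /= z_orth !mulr0 add0r; congr (_ + _).
rewrite exchange_big /=.
(* Adding and subtracting [c2] on the diagonal completes the double sum, which vanishes by
   [z_orth]. *)
rewrite (eq_bigr (fun i => (c1 - c2) * dot (z i) (z i) + c2 * \sum_j dot (z i) (z j))).
  rewrite big_split /= -!big_distrr /=.
  under [X in c2 * X]eq_bigr do rewrite z_orth.
  rewrite big1_eq mulr0 addr0 !mulrA; congr (_ * _).
  by rewrite /c1 /c2; field; rewrite N1 N2 K2.
move=> i _; rewrite exchange_big (bigD1 i) //= [X in c2 * X](bigD1 i) //=.
rewrite -big_distrl /= (eq_bigr (fun A => q A * (i \in A)%:R)); last first.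
  by move=> A _; case: (i \in A); rewrite ?mulr1 ?mulr0.
rewrite without_replacement_mem mulrDr addrA -mulrDl subrK; congr (_ + _).
rewrite big_distrr; apply: eq_bigr => j ji; rewrite -big_distrl /=.
by rewrite without_replacement_mem2 // eq_sym.
Qed.

End WithoutReplacement.

(** * Runs of FedAvg *)

Section Draws.
Variables (R : realType) (N K : nat) (n : 'I_N -> nat).

Definition draw_type (i : nat * 'I_N + nat) : finType :=
  match i with inl a => 'I_(n a.2) | inr _ => {set 'I_N} end.

Definition draw_law (i : nat * 'I_N + nat) : draw_type i -> R :=
  match i with
  | inl a => fun=> (n a.2)%:R^-1
  | inr _ => without_replacement R K
  end.

(** A finite enumeration of [draws E T]; the range of server draws includes time [T]. *)
Definition draw_seq (E T : nat) : seq (nat * 'I_N + nat) :=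
  [seq inl a | a <- [seq (t, k) | t <- iota 0 T, k <- enum 'I_N]] ++
  [seq inr t | t <- iota 0 T.+1 & sync_time E t].

Lemma draw_seq_uniq E T : uniq (draw_seq E T).
Proof.
rewrite cat_uniq !map_inj_uniq ?filter_uniq ?iota_uniq //=; try by move=> ? ? [].
rewrite allpairs_uniq ?iota_uniq ?enum_uniq //=; last by move=> [? ?] [? ?] _ _ /= [-> ->].
by rewrite andbT; apply/hasPn => _ /mapP[t _ ->]; apply/mapP => -[].
Qed.

Lemma mem_draw_sample E T t k : (inl (t, k) \in draw_seq E T) = (t < T)%N.
Proof.
rewrite mem_cat mem_map; last by move=> ? ? [].
have -> : inl (t, k) \in [seq inr s | s <- iota 0 T.+1 & sync_time E s] = false.
  by apply/mapP => -[].
rewrite orbF; apply/allpairsP/idP => [[[s l]] /= [+ _ [-> _]]|tT].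
  by rewrite mem_iota.
by exists (t, k); rewrite /= mem_iota mem_enum.
Qed.

Lemma mem_draw_server E T t :
  (inr t \in draw_seq E T) = sync_time E t && (t <= T)%N.
Proof.
rewrite mem_cat orbC mem_map; last by move=> ? ? [].
have -> : inr t \in [seq inl a | a <- [seq (t, k) | t <- iota 0 T, k <- enum 'I_N]] = false.
  by apply/mapP => -[].
by rewrite orbF mem_filter mem_iota.
Qed.

Lemma draw_law_ge0 i a : 0 <= draw_law (i := i) a.
Proof.
by case: i a => [[t k]|t] a /=; rewrite ?invr_ge0 ?without_replacement_ge0.
Qed.

Lemma draw_law_sum1 i : (forall k, 0 < n k)%N -> (K <= N)%N ->
  \sum_(a : draw_type i) draw_law a = 1.
Proof.
move=> n0 KN; case: i => [[t k]|t] /=; last exact: without_replacement_sum1.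
rewrite sumr_const card_ord -[_^-1 *+ _]mulr_natr mulVf //.
by rewrite pnatr_eq0 -lt0n.
Qed.

End Draws.

Section Run.
Variables (R : realType) (d N : nat) (X : Type) (n : 'I_N -> nat).
Variables (x : forall k : 'I_N, 'I_(n k) -> X) (loss : 'rV[R]_d -> X -> R).
Variables (p : 'I_N -> R) (K E T : nat) (eta : nat -> R) (w0 : 'rV[R]_d).
Implicit Types (t : nat) (k : 'I_N) (y : forall i, draw_type n i).

Definition iterate t k y : 'rV[R]_d :=
  local_iterate x loss p E K eta w0 (fun s i => y (inl (s, i))) (fun s => y (inr s)) t k.

Definition sampled_grad t k y : 'rV[R]_d :=
  stoch_grad x loss (iterate t k y) (y (inl (t, k))).

Definition exact_grad t k y : 'rV[R]_d :=
  grad (local_objective x loss k) (iterate t k y).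

Definition local_step t k y : 'rV[R]_d := iterate t k y - eta t *: sampled_grad t k y.

Lemma iterateS t k y : iterate t.+1 k y =
  if sync_time E t.+1
  then (N%:R / K%:R) *: \sum_(i in y (inr t.+1)) p i *: local_step t i y
  else local_step t k y.
Proof. by []. Qed.

Lemma iterate0 k y : iterate 0 k y = w0.
Proof. by []. Qed.

Local Opaque iterate.

(** Adaptedness: the iterate at time [t] has seen the samples of earlier steps only, but the server
    draws up to [t] included. *)
Lemma iterate_local t k y y' :
    (forall s i, (s < t)%N -> y (inl (s, i)) = y' (inl (s, i))) ->
    (forall s, (s <= t)%N -> sync_time E s -> y (inr s) = y' (inr s)) ->
  iterate t k y = iterate t k y'.
Proof.
elim: t k => [|t IH] k yy' zz'; first by rewrite !iterate0.
have st i : local_step t i y = local_step t i y'.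
  rewrite /local_step /sampled_grad (IH i) ?yy' // => s *.
    by apply: yy'; lia.
  by apply: zz' => //; lia.
rewrite !iterateS; have [sy|_] := boolP (sync_time E t.+1); last exact: st.
rewrite (zz' _ (leqnn _) sy).
by apply: (congr1 (fun u => _ *: u)); apply: eq_bigr => i _; rewrite st.
Qed.

Lemma local_step_local t k y y' :
    (forall s i, (s <= t)%N -> y (inl (s, i)) = y' (inl (s, i))) ->
    (forall s, (s <= t)%N -> sync_time E s -> y (inr s) = y' (inr s)) ->
  local_step t k y = local_step t k y'.
Proof.
move=> yy' zz'; rewrite /local_step /sampled_grad (yy' t k (leqnn _)).
by rewrite (@iterate_local t k y y') // => s i st; apply: yy'; exact: ltnW.
Qed.

Lemma iterate_resample_sample t k y s i (a : 'I_(n i)) : (t <= s)%N ->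
  iterate t k (@eqtype.dfwith _ (draw_type n) y (inl (s, i)) a) = iterate t k y.
Proof.
move=> ts; apply: iterate_local => [r j rt|r _ _]; rewrite dfwith_out //.
by apply/eqP => -[rs _]; lia.
Qed.

Lemma local_step_resample_server t k y s (a : {set 'I_N}) : (t < s)%N ->
  local_step t k (@eqtype.dfwith _ (draw_type n) y (inr s) a) = local_step t k y.
Proof.
move=> ts; apply: local_step_local => [r j rt|r rt _]; rewrite dfwith_out //.
by apply/eqP => -[rs]; lia.
Qed.

Lemma iterate_sync t k l y : sync_time E t -> iterate t k y = iterate t l y.
Proof.
by case: t => [//|t] sy; rewrite !iterateS sy.
Qed.

Lemma iterate_block_start c k l y : iterate (c * E) k y = iterate (c * E) l y.
Proof.
have [->|cE] := eqVneq (c * E)%N 0%N; first by rewrite !iterate0.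
by apply: iterate_sync; rewrite /sync_time lt0n cE dvdn_mull.
Qed.

(** No synchronisation falls strictly inside a round, so local steps simply accumulate. *)
Lemma iterate_block c r k y : (r < E)%N ->
  iterate (c * E + r) k y = iterate (c * E) k y
    - \sum_(i < r) eta (c * E + i)%N *: sampled_grad (c * E + i) k y.
Proof.
elim: r => [|r IH] rE; first by rewrite addn0 big_ord0 subr0.
rewrite addnS iterateS /sync_time -addnS dvdn_addr ?dvdn_mull //.
rewrite gtnNdvd // andbF /local_step IH; last exact: ltnW.
by rewrite big_ord_recr /= opprD addrA.
Qed.

(** Here [r = E.-1] covers the vectors about to be averaged by the server, with [E] gradients
    each. *)
Lemma local_step_block c r k y : (r < E)%N ->
  local_step (c * E + r) k y = iterate (c * E) k y
    - \sum_(i < r.+1) eta (c * E + i)%N *: sampled_grad (c * E + i) k y.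
Proof.
by move=> rE; rewrite /local_step iterate_block // big_ord_recr /= opprD addrA.
Qed.

End Run.

(** * Convergence *)

(** Linearity of the derivative; this makes a uniformly sampled gradient unbiased. *)
Lemma grad_local_objective (R : realType) (d N : nat) (X : Type) (n : 'I_N -> nat)
    (x : forall k : 'I_N, 'I_(n k) -> X) (loss : 'rV[R]_d -> X -> R) k w :
    (forall z, differentiable (fun u => loss u z) w) ->
  grad (local_objective x loss k) w =
  (n k)%:R^-1 *: \sum_(j < n k) stoch_grad x loss w j.
Proof.
move=> loss_diff; apply/rowP => i; rewrite !mxE summxE.
have dj (j : 'I_(n k)) : derivable (fun u => loss u (x k j)) w (delta_mx 0 i).
  exact: diff_derivable.
have -> : local_objective x loss k =
    (n k)%:R^-1 \*: (\sum_(j < n k) (fun u => loss u (x k j))).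
  by apply: funext => u; rewrite /= fct_sumE.
rewrite deriveZ; last exact: derivable_sum.
by rewrite derive_sum //; congr (_ * _); apply: eq_bigr => j _; rewrite mxE.
Qed.

(** Induction from time 1, where the bound reads [v / gamma]. With [a = gamma + t] the step is [(1 -
    2 / a) * (v / (a - 1)) + v / a ^+ 2 <= v / a]. *)
Lemma step_size_recurrence (R : realType) (Delta : nat -> R) (gamma mu Q v : R) (T : nat) :
    1 <= gamma -> 0 < mu -> 4 * Q / mu ^+ 2 <= v -> 0 <= v -> gamma * Delta 1%N <= v ->
    (forall t, (1 <= t)%N -> (t < T)%N ->
      let eta := 2 / (mu * (gamma + t%:R)) in
      Delta t.+1 <= (1 - mu * eta) * Delta t + eta ^+ 2 * Q) ->
  forall t, (1 <= t)%N -> (t <= T)%N -> Delta t <= v / (gamma + t%:R - 1).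
Proof.
move=> g1 mu0 Qv v0 D1 step; elim=> // -[_ _ _|t IH _ tT].
  by rewrite addrK ler_pdivlMr ?(lt_le_trans _ g1) // mulrC.
have {}IH := IH isT (ltnW tT).
have := step t.+1 isT tT; set a := gamma + t.+1%:R in IH *.
have a2 : 2 <= a by rewrite /a -natr1; have : 0 <= t%:R :> R by []; lra.
have -> : gamma + t.+2%:R - 1 = a by rewrite /a -[t.+2%:R]natr1 addrA addrK.
have a0 : a != 0 by rewrite gt_eqF //; lra.
have a10 : a - 1 != 0 by rewrite gt_eqF //; lra.
have m0 : mu != 0 by rewrite gt_eqF.
move=> /le_trans; apply.
have -> : mu * (2 / (mu * a)) = 2 / a by field; rewrite m0 a0.
have -> : (2 / (mu * a)) ^+ 2 * Q = 4 * Q / mu ^+ 2 / a ^+ 2 by field; rewrite m0 a0.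
have c0 : 0 <= 1 - 2 / a by rewrite subr_ge0 ler_pdivrMr ?mul1r //; lra.
have i0 : 0 <= (a ^+ 2)^-1 by rewrite invr_ge0 sqr_ge0.
apply: (le_trans (lerD (ler_wpM2l c0 IH) (ler_wpM2r i0 Qv))).
have -> : (1 - 2 / a) * (v / (a - 1)) + v / a ^+ 2 = v / a - v / (a ^+ 2 * (a - 1)).
  by field; rewrite a0 a10.
by rewrite gerBl divr_ge0 // mulr_ge0 ?sqr_ge0 //; lra.
Qed.

Local Opaque iterate.

(** Written as scalar multiples of single products, so that the mean can be taken term by term. *)
Lemma dot_sub_sum (R : realType) (d N : nat) (p : 'I_N -> R) (a : 'rV[R]_d)
    (e : 'I_N -> 'rV[R]_d) c :
  dot (a - c *: \sum_k p k *: e k) (a - c *: \sum_k p k *: e k) =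
  dot a a + (\sum_k (- (2 * c * p k)) * dot a (e k)
    + \sum_k \sum_l (c ^+ 2 * (p k * p l)) * dot (e l) (e k)).
Proof.
have -> : \sum_k (- (2 * c * p k)) * dot a (e k) = - (2 * c) * dot a (\sum_k p k *: e k).
  rewrite dot_sumr big_distrr; apply: eq_bigr => k _ /=; rewrite dotZr; ring.
have -> : \sum_k \sum_l (c ^+ 2 * (p k * p l)) * dot (e l) (e k) =
    c ^+ 2 * dot (\sum_k p k *: e k) (\sum_k p k *: e k).
  rewrite dot_sumr big_distrr; apply: eq_bigr => k _ /=.
  rewrite dot_suml big_distrr; apply: eq_bigr => l _ /=; rewrite dotZr dotZl; ring.
by move: (\sum_k _) => u; rewrite !dotE (dotC u a); ring.
Qed.

(** Separates the exact step from the gradient noise [s k - g k]. *)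
Lemma sub_sum_split (R : realType) (d N : nat) (p : 'I_N -> R) (a b : 'rV[R]_d)
    (s g : 'I_N -> 'rV[R]_d) c :
  a - c *: (\sum_k p k *: s k) - b =
  a - b - c *: (\sum_k p k *: g k) - c *: \sum_k p k *: (s k - g k).
Proof.
have -> : \sum_k p k *: (s k - g k) = \sum_k p k *: s k - \sum_k p k *: g k.
  by rewrite -sumrB; apply: eq_bigr => k _; rewrite scalerBr.
by rewrite scalerBr opprB addrA subrK addrAC.
Qed.

(** * Recurrence for the mean squared distance to the minimiser *)

Section Analysis.
Variables (R : realType) (d N : nat) (X : Type) (n : 'I_N -> nat).
Variables (x : forall k : 'I_N, 'I_(n k) -> X) (loss : 'rV[R]_d -> X -> R).
Variables (p : 'I_N -> R) (K E T : nat) (eta : nat -> R) (w0 : 'rV[R]_d).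
Variables (L mu G : R) (sigma m : 'I_N -> R) (wstar : 'rV[R]_d).
Variable y0 : forall i, draw_type n i.
Implicit Types (t : nat) (k : 'I_N) (y : forall i, draw_type n i).
Hypotheses (n_gt0 : forall k, (0 < n k)%N) (p_eq : forall k, p k = N%:R^-1).
Hypotheses (N_ge2 : (2 <= N)%N) (K_gt0 : (1 <= K)%N) (K_leN : (K <= N)%N).
Hypothesis E_gt0 : (1 <= E)%N.

Local Notation Fk := (local_objective x loss).
Local Notation W := (iterate x loss p K E eta w0).
Local Notation SG := (sampled_grad x loss p K E eta w0).
Local Notation EG := (exact_grad x loss p K E eta w0).
Local Notation V := (local_step x loss p K E eta w0).
Local Notation Ex f := (mean (@draw_law R N K n) (draw_seq N E T) f y0).

Definition average t y := \sum_k p k *: W t k y.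
Definition average_step t y := \sum_k p k *: V t k y.
Definition average_grad t y := \sum_k p k *: EG t k y.

Hypothesis loss_diff : forall z w, differentiable (fun u => loss u z) w.

Let law_sum1 i : \sum_(a : draw_type n i) draw_law R K a = 1.
Proof. exact: draw_law_sum1. Qed.

Let law_ge0 i (a : draw_type n i) : 0 <= draw_law R K a.
Proof. exact: draw_law_ge0. Qed.

Let p_ge0 k : 0 <= p k.
Proof. by rewrite p_eq invr_ge0. Qed.

Let N_neq0 : N%:R != 0 :> R.
Proof. by rewrite pnatr_eq0 -lt0n (leq_trans _ N_ge2). Qed.

Let p_sum1 : \sum_k p k = 1.
Proof.
under eq_bigr do rewrite p_eq.
by rewrite sumr_const card_ord -[_^-1 *+ _]mulr_natr mulVf.
Qed.

(** Averaging first over the sample of device [k] at step [t] changes neither [h] nor the iterate,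
    and turns the sampled gradient into the exact one. *)
Lemma mean_noise t k (h : (forall i, draw_type n i) -> 'rV[R]_d) : (t < T)%N ->
    (forall y (a : 'I_(n k)), h (@eqtype.dfwith _ (draw_type n) y (inl (t, k)) a) = h y) ->
  Ex (fun y => dot (h y) (SG t k y - EG t k y)) = 0.
Proof.
move=> tT hy; rewrite -(mean_resample law_sum1 (i := inl (t, k))) ?mem_draw_sample //.
suff -> : resample (@draw_law R N K n) (inl (t, k))
    (fun y => dot (h y) (SG t k y - EG t k y)) = fun=> 0 by rewrite mean0.
apply: funext => y; rewrite /resample /=.
under eq_bigr => a _ do rewrite hy /sampled_grad /exact_grad iterate_resample_sample //
  dfwith_in -dotZr.
rewrite -dot_sumr -scaler_sumr sumrB scalerBr -grad_local_objective //.
rewrite sumr_const card_ord -[grad _ _ *+ _]scaler_nat.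
rewrite [_ *: (_ *: grad _ _)]scalerA mulVf ?pnatr_eq0 -?lt0n //.
by rewrite scale1r subrr dotC dot0l.
Qed.

Lemma average_stepE t y :
  average_step t y = average t y - eta t *: \sum_k p k *: SG t k y.
Proof.
rewrite scaler_sumr -sumrB; apply: eq_bigr => k _.
by rewrite /local_step scalerBr !scalerA (mulrC (p k)).
Qed.

Hypothesis noise_le : forall k t, (t < T)%N ->
  Ex (fun y => dot (SG t k y - EG t k y) (SG t k y - EG t k y)) <= sigma k ^+ 2.

(** The noise is uncorrelated with the exact step and across devices, so only its diagonal terms
    remain. *)
Lemma mean_average_step t : (t < T)%N ->
  Ex (fun y => dot (average_step t y - wstar) (average_step t y - wstar)) <=
  Ex (fun y => dot (average t y - wstar - eta t *: average_grad t y)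
                   (average t y - wstar - eta t *: average_grad t y))
  + eta t ^+ 2 * \sum_k p k ^+ 2 * sigma k ^+ 2.
Proof.
move=> tT; pose e k y := SG t k y - EG t k y.
pose A y := average t y - wstar - eta t *: average_grad t y.
have -> : (fun y => dot (average_step t y - wstar) (average_step t y - wstar)) =
    fun y => dot (A y) (A y) + (\sum_k (- (2 * eta t * p k)) * dot (A y) (e k y)
      + \sum_k \sum_l (eta t ^+ 2 * (p k * p l)) * dot (e l y) (e k y)).
  apply: funext => y.
  rewrite average_stepE (sub_sum_split _ _ _ _ (fun k => EG t k y)).
  exact: dot_sub_sum.
rewrite !meanD !mean_sum lerD2l.
have A_res k y (a : 'I_(n k)) : A (@eqtype.dfwith _ (draw_type n) y (inl (t, k)) a) = A y.
  rewrite /A /average /average_grad /exact_grad.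
  have res l := @iterate_resample_sample _ _ _ _ _ x loss p K E eta w0 t l y t k a (leqnn t).
  congr (_ - _ - _ *: _); apply: eq_bigr => l _; first by rewrite res.
  by rewrite res.
rewrite [X in X + _]big1 => [|k _]; last first.
  by rewrite meanZ mean_noise; [rewrite mulr0|exact: tT|exact: A_res].
rewrite add0r big_distrr; apply: ler_sum => k _ /=.
(* For [l != k], the noise of device [l] ignores the sample of device [k], so [mean_noise] applies
   with it as [h]. *)
rewrite mean_sum (bigD1 k) //= big1 ?addr0 => [|l lk]; last first.
  rewrite meanZ mean_noise; [by rewrite mulr0|exact: tT|move=> y a].
  rewrite /e /exact_grad /sampled_grad iterate_resample_sample // dfwith_out //.
  by apply: contraNneq lk => -[->].
rewrite meanZ -mulrA -expr2 ler_wpM2l ?sqr_ge0 // ler_wpM2l ?sqr_ge0 //.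
exact: noise_le.
Qed.

Hypothesis grad_le : forall k t, (t < T)%N ->
  Ex (fun y => dot (SG t k y) (SG t k y)) <= G ^+ 2.
Hypothesis eta_gt0 : forall t, 0 < eta t.
Hypothesis eta_double : forall s t, (t <= s + E)%N -> eta s <= 2 * eta t.

(** Cauchy-Schwarz gives one factor [r] and the number of terms another; the 4 comes from comparing
    step sizes of one round with [eta t]. *)
Lemma mean_path c r t k : (r <= E)%N -> (t <= c * E + E)%N -> (c * E + r <= T)%N ->
  Ex (fun y => dot (\sum_(i < r) eta (c * E + i)%N *: SG (c * E + i) k y)
                   (\sum_(i < r) eta (c * E + i)%N *: SG (c * E + i) k y)) <=
  4 * eta t ^+ 2 * r%:R ^+ 2 * G ^+ 2.
Proof.
move=> rE tc crT; apply: (@le_trans _ _ (Ex (fun y =>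
    \sum_(i < r) (r%:R * eta (c * E + i)%N ^+ 2) *
      dot (SG (c * E + i) k y) (SG (c * E + i) k y)))).
  apply: ler_mean => // y; apply: le_trans (dot_sum_le _) _.
  by rewrite big_distrr; apply: ler_sum => i _ /=; rewrite dotZl dotZr !mulrA.
rewrite mean_sum; apply: (@le_trans _ _ (\sum_(i < r) r%:R * (2 * eta t) ^+ 2 * G ^+ 2)).
  apply: ler_sum => i _; rewrite meanZ; apply: ler_pM.
  - by rewrite mulr_ge0 ?sqr_ge0.
  - rewrite -(mean_cst law_sum1 (draw_seq N E T) 0 y0); apply: ler_mean => // y.
    exact: dot_ge0.
  - rewrite ler_wpM2l // lerXn2r ?nnegrE ?mulr_ge0 ?(ltW (eta_gt0 _)) //.
    by apply: eta_double; lia.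
  - by apply: grad_le; have := ltn_ord i; lia.
rewrite sumr_const card_ord -[X in X <= _]mulr_natr le_eqVlt; apply/orP; left; apply/eqP; ring.
Qed.

(** Recentred at the common start of the round, each device has moved by [r = t %% E] gradient
    steps, at most [E - 1]. *)
Lemma mean_drift t : (t < T)%N ->
  Ex (fun y => \sum_k p k * dot (W t k y - average t y) (W t k y - average t y)) <=
  4 * eta t ^+ 2 * (E%:R - 1) ^+ 2 * G ^+ 2.
Proof.
move=> tT; pose c := (t %/ E)%N; pose r := (t %% E)%N.
have tE : t = (c * E + r)%N by exact: divn_eq.
have rE : (r < E)%N by rewrite ltn_mod.
pose u k y := \sum_(i < r) eta (c * E + i)%N *: SG (c * E + i) k y.
apply: (@le_trans _ _ (Ex (fun y => \sum_k p k * dot (u k y) (u k y)))).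
  apply: ler_mean => // y.
  pose k0 : 'I_N := Ordinal N_ge2.
  apply: le_trans (sum_dot_centered_le _ (W (c * E) k0 y) p_sum1) _.
  apply: ler_sum => k _; rewrite tE iterate_block //.
  rewrite (@iterate_block_start _ _ _ _ _ x loss p K E eta w0 c k k0).
  by rewrite [_ - _ - _]addrAC subrr add0r dotNl dotNr opprK.
rewrite mean_sum; apply: (@le_trans _ _ (\sum_k p k * (4 * eta t ^+ 2 * r%:R ^+ 2 * G ^+ 2))).
  apply: ler_sum => k _; rewrite meanZ ler_wpM2l //.
  by apply: mean_path; lia.
rewrite -big_distrl /= p_sum1 mul1r ler_wpM2r ?sqr_ge0 // ler_wpM2l //.
  by rewrite mulr_ge0 ?sqr_ge0.
rewrite lerXn2r ?nnegrE ?subr_ge0 ?ler1n //.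
by rewrite lerBrDr natr1 ler_nat.
Qed.

(** With equal weights the factor [N / K] times [p i] is [1 / K]: the server forms the plain sample
    mean. *)
Lemma average_sync t y : sync_time E t.+1 ->
  average t.+1 y = K%:R^-1 *: \sum_(i in y (inr t.+1)) V t i y.
Proof.
move=> sy; rewrite /average.
have -> : \sum_k p k *: W t.+1 k y =
    \sum_k p k *: (K%:R^-1 *: \sum_(i in y (inr t.+1)) V t i y).
  apply: eq_bigr => k _; rewrite iterateS sy; congr (_ *: _).
  under eq_bigr do rewrite p_eq.
  by rewrite -scaler_sumr scalerA mulrAC divff // mul1r.
by rewrite -scaler_suml p_sum1 scale1r.
Qed.

Lemma average_nosync t y : ~~ sync_time E t.+1 -> average t.+1 y = average_step t y.
Proof.
by move=> sy; apply: eq_bigr => k _; rewrite iterateS (negbTE sy).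
Qed.

Local Notation C := ((N%:R - K%:R) / (N%:R - 1) * (4 / K%:R) * E%:R ^+ 2 * G ^+ 2).

Let N1_gt0 : 0 < N%:R - 1 :> R.
Proof. by rewrite subr_gt0 ltr1n. Qed.

(** At a synchronisation, averaging over the server draw adds the sampling variance, bounded by the
    movement over a full round of [E] steps. At other times the two averages coincide. *)
Lemma mean_average_next t : (t < T)%N ->
  Ex (fun y => dot (average t.+1 y - wstar) (average t.+1 y - wstar)) <=
  Ex (fun y => dot (average_step t y - wstar) (average_step t y - wstar)) + eta t ^+ 2 * C.
Proof.
move=> tT; have N1 := N1_gt0.
have KN : 0 <= N%:R - K%:R :> R by rewrite subr_ge0 ler_nat.
have [sy|sy] := boolP (sync_time E t.+1); last first.
  under eq_fun do rewrite average_nosync //.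
  have r0 : 0 <= (N%:R - K%:R) / (N%:R - 1) * (4 / K%:R) :> R.
    by apply: mulr_ge0; apply: divr_ge0 => //; exact: ltW.
  rewrite lerDl; apply: mulr_ge0; first exact: sqr_ge0.
  by apply: mulr_ge0; [apply: mulr_ge0 => //|]; exact: sqr_ge0.
rewrite -(mean_resample law_sum1 (i := inr t.+1)); last by rewrite mem_draw_server sy.
pose cst : R := (N%:R - K%:R) / (K%:R * (N%:R - 1)).
have -> : resample (@draw_law R N K n) (inr t.+1)
    (fun y => dot (average t.+1 y - wstar) (average t.+1 y - wstar)) =
    fun y => dot (average_step t y - wstar) (average_step t y - wstar) +
      cst * \sum_k p k * dot (V t k y - average_step t y) (V t k y - average_step t y).
  apply: funext => y; rewrite /resample /=.
  under eq_bigr => A _.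
    rewrite average_sync // dfwith_in.
    under eq_bigr do rewrite local_step_resample_server //.
    over.
  rewrite without_replacement_variance // /average_step.
  have -> : \sum_k p k *: V t k y = \sum_k N%:R^-1 *: V t k y.
    by apply: eq_bigr => k _; rewrite p_eq.
  by congr (_ + _ * _); apply: eq_bigr => k _; rewrite p_eq.
rewrite meanD meanZ lerD2l.
(* [t.+1] is a positive multiple of [E], so [t] is the last step of its round. *)
have [c cE] : exists c, t = (c * E + E.-1)%N.
  by move: sy => /andP[_ /dvdnP[[|c] //]]; rewrite mulSn => e; exists c; lia.
pose u k y := \sum_(i < E) eta (c * E + i)%N *: SG (c * E + i) k y.
have cst0 : 0 <= cst by rewrite divr_ge0 ?mulr_ge0 // ltW.
apply: (@le_trans _ _ (cst * (4 * eta t ^+ 2 * E%:R ^+ 2 * G ^+ 2))); last first.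
  rewrite le_eqVlt; apply/orP; left; apply/eqP; rewrite /cst; field.
  by rewrite pnatr_eq0 -lt0n K_gt0 gt_eqF.
rewrite ler_wpM2l //.
apply: (@le_trans _ _ (Ex (fun y => \sum_k p k * dot (u k y) (u k y)))).
  apply: ler_mean => // y.
  pose k0 : 'I_N := Ordinal N_ge2.
  apply: le_trans (sum_dot_centered_le _ (W (c * E) k0 y) p_sum1) _.
  apply: ler_sum => k _.
  rewrite cE local_step_block ?prednK //.
  rewrite (@iterate_block_start _ _ _ _ _ x loss p K E eta w0 c k k0).
  by rewrite [_ - _ - _]addrAC subrr add0r dotNl dotNr opprK.
rewrite mean_sum; apply: (@le_trans _ _ (\sum_k p k * (4 * eta t ^+ 2 * E%:R ^+ 2 * G ^+ 2))).
  apply: ler_sum => k _; rewrite meanZ ler_wpM2l //.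
  by apply: mean_path; lia.
by rewrite -big_distrl /= p_sum1 mul1r.
Qed.

Hypotheses (L_gt0 : 0 < L) (mu_gt0 : 0 < mu).
Hypothesis eta_le : forall t, 4 * L * eta t <= 1.
Hypothesis Fk_smooth : forall k v w,
  Fk k v <= Fk k w + dot (v - w) (grad (Fk k) w) + L / 2 * dot (v - w) (v - w).
Hypothesis Fk_convex : forall k v w,
  Fk k w + dot (v - w) (grad (Fk k) w) + mu / 2 * dot (v - w) (v - w) <= Fk k v.
Hypothesis Fk_min : forall k v, m k <= Fk k v.
Hypothesis wstar_min : forall v, \sum_k p k * Fk k wstar <= \sum_k p k * Fk k v.

Local Notation B := (\sum_k p k ^+ 2 * sigma k ^+ 2
  + 6 * L * (\sum_k p k * Fk k wstar - \sum_k p k * m k)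
  + 8 * (E%:R - 1) ^+ 2 * G ^+ 2).

(** Server sampling gives [C]; noise, heterogeneity and twice the drift give the three terms of
    [B]. *)
Lemma mean_distance_step t : (t < T)%N ->
  Ex (fun y => dot (average t.+1 y - wstar) (average t.+1 y - wstar)) <=
  (1 - mu * eta t) * Ex (fun y => dot (average t y - wstar) (average t y - wstar))
  + eta t ^+ 2 * (B + C).
Proof.
move=> tT; apply: le_trans (mean_average_next tT) _.
rewrite mulrDr addrA lerD2r; apply: le_trans (mean_average_step tT) _.
pose c := 6 * L * eta t ^+ 2 * (\sum_k p k * Fk k wstar - \sum_k p k * m k).
have step : Ex (fun y => dot (average t y - wstar - eta t *: average_grad t y)
      (average t y - wstar - eta t *: average_grad t y)) <=
    Ex (fun y => (1 - mu * eta t) * dot (average t y - wstar) (average t y - wstar)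
      + (2 * \sum_k p k * dot (W t k y - average t y) (W t k y - average t y) + c)).
  apply: ler_mean => // y; rewrite addrA.
  exact: (gradient_step_contraction p_ge0 p_sum1 L_gt0 mu_gt0 (eta_gt0 t) (eta_le t)
    Fk_smooth Fk_convex Fk_min wstar_min).
rewrite !meanD !meanZ mean_cst // in step.
have := mean_drift tT; rewrite /c in step.
move: step; move: (Ex _) (Ex _) (Ex _) => X1 X2 X3 s1 s2; lra.
Qed.

End Analysis.

(** * Properties of the step sizes *)

Section Rate.
Variables (R : realType) (L mu : R) (E : nat).
Hypotheses (mu_gt0 : 0 < mu) (mu_le : mu <= L).

Let gamma : R := Num.max (8 * (L / mu)) E%:R.
Let eta (t : nat) : R := 2 / (mu * (gamma + t%:R)).

Let gamma_ge : 8 * L <= mu * gamma.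
Proof.
by rewrite [leRHS]mulrC -ler_pdivrMr // -mulrA le_max lexx.
Qed.

Lemma step_shift_ge8 : 8 <= gamma.
Proof.
rewrite le_max; apply/orP; left.
by rewrite ler_peMr // ler_pdivlMr // mul1r.
Qed.

Let den_gt0 (t : nat) : 0 < mu * (gamma + t%:R).
Proof.
rewrite mulr_gt0 //; have := step_shift_ge8; have : 0 <= t%:R :> R by []; lra.
Qed.

Lemma step_size_gt0 t : 0 < eta t.
Proof. by rewrite divr_gt0. Qed.

(** This uses the part [8 * (L / mu)] of the maximum [gamma]. *)
Lemma step_size_le t : 4 * L * eta t <= 1.
Proof.
rewrite mulrA ler_pdivrMr // mul1r mulrDr.
have : 0 <= mu * t%:R by rewrite mulr_ge0 // ltW.
by have := gamma_ge; lra.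
Qed.

(** This uses the part [E] of the maximum: [gamma + t <= gamma + s + E <= 2 * (gamma + s)]. *)
Lemma step_size_double s t : (t <= s + E)%N -> eta s <= 2 * eta t.
Proof.
rewrite -(ler_nat R) natrD => tsE.
rewrite mulrA ler_pdivrMr // mulrAC ler_pdivlMr // mulrCA [leRHS]mulrCA ler_pM2l //.
have : E%:R <= gamma by rewrite le_max lexx orbT.
have : 0 <= s%:R :> R by [].
lra.
Qed.

End Rate.

Theorem theorem3 (R : realType) (d N : nat) (d_gt0 : (0 < d)%N)
    (N_ge2 : (2 <= N)%N) (p : 'I_N -> R) (p_eq : forall k, p k = N%:R^-1)
    (X : Type) (loss : 'rV[R]_d -> X -> R)
    (loss_diff : forall (z : X) (w : 'rV[R]_d),
      differentiable (fun u => loss u z) w)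
    (n : 'I_N -> nat) (n_gt0 : forall k, (0 < n k)%N)
    (x : forall k : 'I_N, 'I_(n k) -> X)
    (K E T : nat) (K_gt0 : (1 <= K)%N) (K_leN : (K <= N)%N)
    (E_gt0 : (1 <= E)%N) (T_gt0 : (1 <= T)%N) (E_dvd_T : (E %| T)%N)
    (disp : measure_display) (Omega : measurableType disp)
    (P : probability Omega R)
    (xi : nat -> forall k : 'I_N, Omega -> 'I_(n k))
    (S : nat -> Omega -> {set 'I_N})
    (sampling : schemeII_sampling P xi S E K T)
    (w0 : 'rV[R]_d) (L mu G : R) (sigma : 'I_N -> R)
    (wstar : 'rV[R]_d) (Fkstar : 'I_N -> R) :
  let Fk := local_objective x loss in
  let F := global_objective x loss p in
  let kappa : R := L / mu in
  let gamma : R := Num.max (8 * kappa) E%:R in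
  let eta := fun t : nat => 2 / (mu * (gamma + t%:R)) in
  let wk := fun (t : nat) (k : 'I_N) (omega : Omega) =>
    local_iterate x loss p E K eta w0 (fun s i => xi s i omega)
      (fun s => S s omega) t k in
  let w := fun (t : nat) (omega : Omega) =>
    average_iterate x loss p E K eta w0 (fun s i => xi s i omega)
      (fun s => S s omega) t in
  let Fstar : R := F wstar in
  let Gamma : R := Fstar - \sum_(k < N) p k * Fkstar k in
  let B : R := \sum_(k < N) p k ^+ 2 * sigma k ^+ 2 + 6 * L * Gamma
           + 8 * (E%:R - 1) ^+ 2 * G ^+ 2 in
  let C : R := (N%:R - K%:R) / (N%:R - 1) * (4 / K%:R) * E%:R ^+ 2 * G ^+ 2 in
  is_minimizer F wstar ->
  (forall k, is_min (Fk k) (Fkstar k)) ->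
  (forall k, L_smooth L (Fk k)) ->
  0 < mu ->
  (forall k, strongly_convex mu (Fk k)) ->
  (forall k t, (t < T)%N ->
    ('E_P[fun omega => (enorm (stoch_grad x loss (wk t k omega) (xi t k omega)
                              - grad (Fk k) (wk t k omega)) ^+ 2)%R]
     <= (sigma k ^+ 2)%:E)%E) ->
  (forall k t, (t < T)%N ->
    ('E_P[fun omega => (enorm (stoch_grad x loss (wk t k omega)
                                         (xi t k omega)) ^+ 2)%R]
     <= (G ^+ 2)%:E)%E) ->
  ('E_P[fun omega => F (w T omega)] - Fstar%:E
   <= (kappa / (gamma + T%:R - 1))%:E
      * ((2 * (B + C) / mu)%:E
         + (mu * gamma / 2)%:E
           * 'E_P[fun omega => (enorm (w 1%N omega - wstar) ^+ 2)%R]))%E.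
Proof.
move=> Fk F kappa gamma eta wk w Fstar Gamma B C wstar_min Fk_min Fk_smooth mu_gt0
  Fk_convex noise_le grad_le.
pose Y (i : nat * 'I_N + nat) : Omega -> draw_type n i :=
  match i with inl a => xi a.1 a.2 | inr t => S t end.
(* Default values for draws outside [draw_seq]; the functions passed to [Exp] ignore them. *)
pose y0 (i : nat * 'I_N + nat) : draw_type n i :=
  match i with inl a => Ordinal (n_gt0 a.2) | inr _ => finset.set0 end.
pose Ex f := mean (@draw_law R N K n) (draw_seq N E T) f y0.
have in_draws i : i \in draw_seq N E T -> draws E T i.
  by case: i => [[t k]|t]; rewrite ?mem_draw_sample ?mem_draw_server.
have Y_random i : draws E T i -> discrete_random (Y i).
  case: i => [[t k]|t] /= Dt; first exact: (sample_random sampling).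
  by case/andP: Dt => *; apply: (devices_random sampling).
have Y_law i a : draws E T i -> P [set omega | Y i omega = a] = (draw_law R K a)%:E.
  case: i a => [[t k]|t] /= a Dt; first exact: (sample_uniform sampling).
  case/andP: Dt => st tT; rewrite (devices_uniform sampling) // /without_replacement.
  by case: ifP.
have Y_indep : mutually_independent P (draws E T) (fun i => generated_events (Y i)).
  have := draws_independent sampling.
  by congr (mutually_independent _ _ _); apply: funext => -[[t k]|t].
have Exp f : (forall y y', (forall i, i \in draw_seq N E T -> y i = y' i) -> f y = f y') ->
    ('E_P[fun omega => f (fun i => Y i omega)] = (Ex f)%:E)%E.
  exact: (expectation_mean Y_random Y_law Y_indep y0 (draw_seq_uniq N E T) in_draws).
pose W t k y := iterate x loss p K E eta w0 t k y.
have W_local t k y y' : (t <= T)%N -> (forall i, i \in draw_seq N E T -> y i = y' i) ->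
    W t k y = W t k y'.
  move=> tT yy'; apply: iterate_local => [s i st|s st sy]; apply: yy'.
    by rewrite mem_draw_sample; lia.
  by rewrite mem_draw_server sy; lia.
pose avg := average x loss p K E eta w0.
have avg_local t y y' : (t <= T)%N -> (forall i, i \in draw_seq N E T -> y i = y' i) ->
    avg t y = avg t y'.
  by move=> tT yy'; apply: eq_bigr => k _; rewrite -/(W t k y) (W_local _ _ _ _ tT yy').
pose SG := sampled_grad x loss p K E eta w0.
pose EG := exact_grad x loss p K E eta w0.
have noise_le' k t : (t < T)%N ->
    Ex (fun y => dot (SG t k y - EG t k y) (SG t k y - EG t k y))
    <= sigma k ^+ 2.
  move=> tT; rewrite -lee_fin -Exp.
    apply: le_trans (noise_le k t tT); rewrite le_eqVlt; apply/orP; left; apply/eqP.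
    by congr expectation; apply: funext => omega; rewrite enorm_sqr.
  move=> y y' yy'; rewrite /SG /EG /sampled_grad /exact_grad -/(W t k y).
  rewrite (W_local _ _ _ _ (ltnW tT) yy').
  by rewrite (yy' (inl (t, k))) // mem_draw_sample.
have grad_le' k t : (t < T)%N ->
    Ex (fun y => dot (SG t k y) (SG t k y)) <= G ^+ 2.
  move=> tT; rewrite -lee_fin -Exp.
    apply: le_trans (grad_le k t tT); rewrite le_eqVlt; apply/orP; left; apply/eqP.
    by congr expectation; apply: funext => omega; rewrite enorm_sqr.
  move=> y y' yy'; rewrite /SG /sampled_grad -/(W t k y).
  rewrite (W_local _ _ _ _ (ltnW tT) yy').
  by rewrite (yy' (inl (t, k))) // mem_draw_sample.
pose k0 : 'I_N := Ordinal N_ge2.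
(* Hence [L] is positive and [gamma] is at least 8. *)
have mu_le : mu <= L := smooth_convex_le d_gt0 (Fk_smooth k0) (Fk_convex k0).
have L_gt0 : 0 < L := lt_le_trans mu_gt0 mu_le.
have Fk_smooth' k v u :
    Fk k v <= Fk k u + dot (v - u) (grad (Fk k) u) + L / 2 * dot (v - u) (v - u).
  by rewrite -enorm_sqr; apply: Fk_smooth.
have Fk_convex' k v u :
    Fk k u + dot (v - u) (grad (Fk k) u) + mu / 2 * dot (v - u) (v - u) <= Fk k v.
  by rewrite -enorm_sqr; apply: Fk_convex.
have Fk_min' k v : Fkstar k <= Fk k v by have [u um ->] := Fk_min k; apply: um.
have p_ge0 k : 0 <= p k by rewrite p_eq invr_ge0.
have p_sum1 : \sum_k p k = 1.
  under eq_bigr do rewrite p_eq.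
  rewrite sumr_const card_ord -[_^-1 *+ _]mulr_natr mulVf // pnatr_eq0 -lt0n.
  exact: (leq_trans _ N_ge2).
pose Delta t := Ex (fun y => dot (avg t y - wstar) (avg t y - wstar)).
have Delta_step t : (t < T)%N ->
    Delta t.+1 <= (1 - mu * eta t) * Delta t + eta t ^+ 2 * (B + C).
  exact: (mean_distance_step n_gt0 p_eq N_ge2 K_gt0 K_leN E_gt0 loss_diff noise_le' grad_le'
    (step_size_gt0 E mu_gt0 mu_le) (step_size_double mu_gt0 mu_le) L_gt0 mu_gt0
    (step_size_le E mu_gt0 mu_le) Fk_smooth' Fk_convex' Fk_min' wstar_min).
have gamma8 : 8 <= gamma := step_shift_ge8 E mu_gt0 mu_le.
have law1 i : \sum_(a : draw_type n i) draw_law R K a = 1 by exact: draw_law_sum1.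
have law0 i (a : draw_type n i) : 0 <= draw_law R K a by exact: draw_law_ge0.
have Delta_ge0 t : 0 <= Delta t.
  rewrite -(mean_cst law1 (draw_seq N E T) 0 y0); apply: ler_mean => // y.
  exact: dot_ge0.
have BC_ge0 : 0 <= B + C.
  have G2 : 0 <= G ^+ 2 by exact: sqr_ge0.
  have B1 : 0 <= \sum_k p k ^+ 2 * sigma k ^+ 2.
    by apply: sumr_ge0 => k _; rewrite mulr_ge0 ?sqr_ge0.
  have B2 : 0 <= 6 * L * Gamma.
    rewrite mulr_ge0 ?(mulr_ge0, ltW L_gt0) // subr_ge0.
    by apply: ler_sum => k _; rewrite ler_wpM2l.
  have B3 : 0 <= 8 * (E%:R - 1) ^+ 2 * G ^+ 2 by rewrite mulr_ge0 // mulr_ge0 ?sqr_ge0.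
  have C1 : 0 <= (N%:R - K%:R) / (N%:R - 1) * (4 / K%:R) :> R.
    apply: mulr_ge0; apply: divr_ge0 => //; first by rewrite subr_ge0 ler_nat.
    by rewrite subr_ge0 ler1n ltnW.
  by rewrite addr_ge0 ?addr_ge0 // mulr_ge0 // mulr_ge0 ?sqr_ge0.
(* A sum of two nonnegative terms dominates both lower bounds that the recurrence puts on [v]. *)
pose v := 4 * (B + C) / mu ^+ 2 + gamma * Delta 1%N.
have Q_ge0 : 0 <= 4 * (B + C) / mu ^+ 2.
  by rewrite divr_ge0 ?sqr_ge0 // mulr_ge0.
have D_ge0 : 0 <= gamma * Delta 1%N by rewrite mulr_ge0 // (le_trans _ gamma8).
have Delta_le : Delta T <= v / (gamma + T%:R - 1).
  apply: (@step_size_recurrence R Delta gamma mu (B + C) v T) => //.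
  - by rewrite (le_trans _ gamma8) // ler1n.
  - by rewrite lerDl.
  - by rewrite addr_ge0.
  - by rewrite lerDr.
  - by move=> t _ tT; apply: Delta_step.
(* The weighted sum of the local quadratic bounds is such a bound for [F] at [wstar], with the
   weighted sum of local gradients as its linear part. *)
have F_le u : F u <= Fstar + L / 2 * dot (u - wstar) (u - wstar).
  apply: (@smooth_minimizer_le _ _ L F wstar (\sum_k p k *: grad (Fk k) wstar)) => // z.
  rewrite (_ : F wstar + _ + _ = \sum_k p k * (Fk k wstar
      + dot (z - wstar) (grad (Fk k) wstar) + L / 2 * dot (z - wstar) (z - wstar))).
    by apply: ler_sum => k _; rewrite ler_wpM2l.
  under [RHS]eq_bigr do rewrite !mulrDr.
  rewrite !big_split /= -big_distrl /= p_sum1 mul1r; congr (_ + _ + _).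
  by rewrite dot_sumr; apply: eq_bigr => k _; rewrite dotZr.
have -> : ('E_P[fun omega => F (w T omega)] = (Ex (fun y => F (avg T y)))%:E)%E.
  rewrite -Exp //; move=> y y' yy'; by rewrite (avg_local _ _ _ (leqnn T) yy').
have -> : ('E_P[fun omega => (enorm (w 1%N omega - wstar) ^+ 2)%R] = (Delta 1%N)%:E)%E.
  rewrite /Delta -Exp.
    by congr expectation; apply: funext => omega; rewrite enorm_sqr.
  by move=> y y' yy'; rewrite (avg_local _ _ _ T_gt0 yy').
rewrite -EFinB -[((mu * gamma / 2)%:E * _)%E]EFinM -EFinD -EFinM lee_fin.
have FT : Ex (fun y => F (avg T y)) <= Fstar + L / 2 * Delta T.
  apply: le_trans (ler_mean law0 _ _ (fun y => F_le (avg T y))) _.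
  by rewrite meanD meanZ mean_cst.
have : L / 2 * Delta T <= L / 2 * (v / (gamma + T%:R - 1)).
  by rewrite ler_wpM2l // divr_ge0 // ltW.
(* The stated constant is exactly [L / 2] times the bound on [Delta T], with [kappa = L / mu] and
   [v] unfolded. *)
have -> : kappa / (gamma + T%:R - 1) * (2 * (B + C) / mu + mu * gamma / 2 * Delta 1%N) =
    L / 2 * (v / (gamma + T%:R - 1)).
  have gT : 0 < gamma + T%:R - 1.
    by rewrite -addrA ltr_wpDr ?subr_ge0 ?ler1n // (lt_le_trans _ gamma8).
  by rewrite /v /kappa; field; rewrite !gt_eqF.
by move=> h; rewrite lerBlDl; apply: le_trans FT _; rewrite lerD2l.
Qed.
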